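(* For positive integers $a$, $b$ and $n$ with $n<2b$ and $a+3b\le 2n$, we have $\alpha(\Gamma(n,\{a,b\}))=\binom{n-1}{b}\binom{b}{a}$.
   Context: $[n]=\{1,\dots,n\}$. Subsets $X,Y$ of $[n]$ are in general position if $X\cup Y=[n]$ or $X\cap Y=\emptyset$. For $a<b$, the vertices of $\Gamma(n,\{a,b\})$ are the pairs $(A,B)$ with $A\subseteq B\subseteq[n]$, $|A|=a$, $|B|=b$ (flags of type $\{a,b\}$), and $(A,B)$, $(A',B')$ are adjacent iff each of $A,B$ is in general position with each of $A',B'$. $\alpha$ denotes the independence number. *)

(* Defs.v *)
From HB Require Import structures.
From mathcomp Require Import all_boot.

Set Implicit Arguments.
Unset Strict Implicit.
Unset Printing Implicit Defensive.

(* Finite simple graphs are given by an adjacency relation on a finType. *)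

Definition independent (V : finType) (e : rel V) (S : {set V}) : bool :=
  [forall x in S, forall y in S, ~~ e x y].

Definition independence_number (V : finType) (e : rel V) : nat :=
  \max_(S : {set V} | independent e S) #|S|.

(* The ground set {1, ..., n} is represented by 'I_n. *)

Definition general_position (n : nat) (X Y : {set 'I_n}) : bool :=
  (X :|: Y == [set: 'I_n]) || (X :&: Y == set0).

Definition is_flag (n a b : nat) (p : {set 'I_n} * {set 'I_n}) : bool :=
  [&& p.1 \subset p.2, #|p.1| == a & #|p.2| == b].

Definition flag (n a b : nat) : finType :=
  {p : {set 'I_n} * {set 'I_n} | is_flag a b p}.

Definition Gamma (n a b : nat) : rel (flag n a b) :=
  fun f g =>
    let: (A, B) := val f in
    let: (A', B') := val g in
    [&& general_position A A', general_position A B',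
        general_position B A' & general_position B B'].

Arguments Gamma : clear implicits.

Lemma Gamma_sym (n a b : nat) : symmetric (Gamma n a b).
Proof.
have gpC (X Y : {set 'I_n}) : general_position X Y = general_position Y X.
  by rewrite /general_position setUC setIC.
case=> [[A B] hf] [[A' B'] hg]; rewrite /Gamma /=.
rewrite (gpC A A') (gpC A B') (gpC B A') (gpC B B').
by congr (_ && _); rewrite andbCA.
Qed.

(* Gamma has no loops, so "independent" does not need to require x != y. *)
Lemma Gamma_irrefl (n a b : nat) :
  0 < a -> a < b -> irreflexive (Gamma n a b).
Proof.
move=> a_gt0 ab [[A B] hf]; rewrite /Gamma /=.
have /and3P[/= _ /eqP cA /eqP cB] := hf.
apply/negbTE/negP => /andP[+ _]; rewrite /general_position setUid setIid.
case/orP=> /eqP A_eq; last by move: a_gt0; rewrite -cA A_eq cards0.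
by move: ab; rewrite -cA -cB A_eq ltnNge subset_leq_card ?subsetT.
Qed.

(* Main.v *)
Require Import Defs.
From mathcomp Require Import all_boot all_fingroup.
From mathcomp Require Import ssralg zmodp zify.

Set Implicit Arguments.
Unset Strict Implicit.
Unset Printing Implicit Defensive.

(** Katona's cycle method. Put c = n - b < b. Since n < 2b and a + b < n, two
flags (A, B) and (A', B') with complements C and C' of size c are adjacent as
soon as C and C' are disjoint, A lies in C' and A' lies in C. On the cycle Z/n,
take the n rotations of the flag with C = [0, c) and A = [b, b + a): because
a + b <= 2c, two rotations with disjoint C are adjacent, so an independent set
contains at most c of them. Averaging over all relabellings of the cycle by
permutations gives n |S| <= c |V| for every independent S; the flags whose B
avoids a fixed point reach this bound. *)

(** * Counting flags and relabelling them by permutations *)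

Section Flags.

Variables (T : finType) (a b : nat).

Lemma card_flags_within (D : {set T}) :
  #|[set p : {set T} * {set T} |
      [&& p.1 \subset p.2, #|p.1| == a, #|p.2| == b & p.2 \subset D]]|
  = 'C(#|D|, b) * 'C(b, a).
Proof.
rewrite -sum1_card.
transitivity (\sum_(B : {set T} | (B \subset D) && (#|B| == b))
                \sum_(A : {set T} | (A \subset B) && (#|A| == a)) 1).
  rewrite pair_big_dep /= (reindex_inj (h := fun p => (p.2, p.1))) /=; last first.
    by move=> [x y] [z t] [-> ->].
  apply: eq_bigl => -[B A] /=; rewrite inE /=.
  by case: (A \subset B); case: (#|A| == a); case: (#|B| == b);
     case: (B \subset D).
transitivity (\sum_(B : {set T} | (B \subset D) && (#|B| == b)) 'C(b, a)).
  apply: eq_bigr => B /andP[_ /eqP cB].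
  rewrite -cB -cards_draws -sum1_card.
  by apply: eq_bigl => A; rewrite inE.
rewrite sum_nat_const -cards_draws; congr (_ * _).
by apply: eq_card => B; rewrite !inE.
Qed.

(** Preimages make membership compute directly and match the order of composition in [permM]. *)
Definition relabel (s : {perm T}) (p : {set T} * {set T}) :=
  (s @^-1: p.1, s @^-1: p.2).

Lemma relabelM s t p : relabel (s * t)%g p = relabel s (relabel t p).
Proof. by congr (_, _); apply/setP => x; rewrite !inE permM. Qed.

Lemma relabel_inj s : injective (relabel s).
Proof.
apply: (can_inj (g := relabel s^-1%g)) => -[A B].
by rewrite -relabelM mulVg; congr (_, _); apply/setP => x; rewrite !inE perm1.
Qed.

End Flags.


Lemma relabel_flag n a b s (p : {set 'I_n} * {set 'I_n}) :
  is_flag a b p -> is_flag a b (relabel s p).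
Proof.
case: p => A B /and3P[/= sAB cA cB].
by rewrite /is_flag /relabel /= preimsetS // !card_preimset ?cA //;
   apply: perm_inj.
Qed.

(* The function x |-> (x \in A, x \in B) has the same multiset of values for
   any two flags of the same type. *)
Lemma relabel_transitive n a b (p q : {set 'I_n} * {set 'I_n}) :
  is_flag a b p -> is_flag a b q -> exists s, q = relabel s p.
Proof.
pose col (p : {set 'I_n} * {set 'I_n}) i := (i \in p.1, i \in p.2).
pose colt p := [tuple col p i | i < n].
have countE r v : is_flag a b r -> count_mem v (colt r) =
    match v with
    | (true, true) => a | (true, false) => 0
    | (false, true) => b - a | (false, false) => n - b end.
  case: r => A B /and3P[/= sAB /eqP cA /eqP cB].
  have cBA : #|B :\: A| = b - a by rewrite cardsD (setIidPr sAB) cA cB.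
  have cBC : #|~: B| = n - b by rewrite cardsCs setCK card_ord cB.
  have sABx x : x \in A -> x \in B by apply: subsetP.
  rewrite -sum1_count big_map big_enum_cond /=.
  case: v => [] [] [];
    [rewrite -[RHS]cA | rewrite -[RHS](cards0 'I_n) | rewrite -[RHS]cBA
    | rewrite -[RHS]cBC]; rewrite -sum1_card; apply: eq_bigl => x;
  rewrite ?inE /col xpair_eqE /=; move: (sABx x);
  by case: (x \in A) => [-> //|_]; case: (x \in B).
move=> fp fq; have /tuple_permP[s /val_inj/(congr1 val) eq_qp] :
    perm_eq (colt q) (colt p).
  by apply/allP => v _ /=; rewrite !countE.
exists s; suff col_qp i : col q i = col p (s i).
  case: p q col_qp {fp fq eq_qp} => A B [A' B'] col_qp.
  by congr (_, _); apply/setP => i; case: (col_qp i) => ? ?; rewrite inE.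
move: eq_qp => /val_inj/(congr1 (fun t => tnth t i)).
by rewrite !tnth_mktuple.
Qed.

(** The permutations carrying [F0] to a given [F] form a coset [t * K] of the stabilizer [K] of
    [F0]. *)
Lemma card_relabel_in (T : finType) (F0 : {set T} * {set T})
    (S : {set {set T} * {set T}}) :
  (forall F, F \in S -> exists s, F = relabel s F0) ->
  #|[set s | relabel s F0 \in S]| =
    #|S| * #|[set s : {perm T} | relabel s F0 == F0]|.
Proof.
move=> orbS; set K := [set s : {perm T} | _ == F0].
rewrite -sum1_card (partition_big (fun s => relabel s F0) (mem S)) /=; last first.
  by move=> s; rewrite inE.
rewrite -sum_nat_const; apply: eq_bigr => F FS.
have [t defF] := orbS F FS.
rewrite -(card_imset K (mulgI t)) -sum1_card; apply: eq_bigl => s.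
rewrite inE; apply/andP/imsetP => [[_ /eqP sF]|[u]].
  exists (t^-1 * s)%g; last by rewrite mulKVg.
  by rewrite inE -(inj_eq (@relabel_inj T t)) -relabelM mulKVg sF defF.
by rewrite inE => /eqP uF ->; rewrite relabelM uF -defF FS.
Qed.

(** Double count the pairs [(s, i)] that land in [S]: for fixed [i], the substitution of [s * r i]
    for [s] gives [#|S| * #|K|] of them; for fixed [s] there are at most [c]. Then cancel [#|K|]. *)
Lemma orbit_averaging (T I : finType) (F0 : {set T} * {set T})
    (V S : {set {set T} * {set T}}) (r : I -> {perm T}) c :
  (forall s, relabel s F0 \in V) ->
  (forall F, F \in V -> exists s, F = relabel s F0) ->
  S \subset V ->
  (forall s, #|[set i | relabel s (relabel (r i) F0) \in S]| <= c) ->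
  #|I| * #|S| <= c * #|V|.
Proof.
move=> orbV Vorb sSV le_c; set K := [set s : {perm T} | relabel s F0 == F0].
have K_gt0 : 0 < #|K|.
  apply/card_gt0P; exists 1%g; rewrite inE; apply/eqP.
  by case: F0 {orbV Vorb le_c K} => A B; congr (_, _); apply/setP => x;
     rewrite !inE perm1.
have cardV : #|{perm T}| = #|V| * #|K|.
  by rewrite -card_relabel_in // -cardsT; apply: eq_card => s; rewrite !inE orbV.
have cardS : #|[set s | relabel s F0 \in S]| = #|S| * #|K|.
  by apply: card_relabel_in => F /(subsetP sSV); apply: Vorb.
rewrite -(leq_pmul2r K_gt0) -!mulnA -cardS -cardV.
rewrite [X in _ <= X]mulnC -[X in X <= _]sum_nat_const -[X in _ <= X]sum_nat_const.
rewrite (eq_bigr (fun i => \sum_(s | relabel s (relabel (r i) F0) \in S) 1)).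
  rewrite (exchange_big_dep xpredT) //=; apply: leq_sum => s _.
  by rewrite (leq_trans _ (le_c s)) // -sum1_card; apply: eq_leq;
     apply: eq_bigl => i; rewrite inE.
move=> i _; rewrite -sum1_card (reindex_inj (mulIg (r i))) /=.
by apply: eq_bigl => s; rewrite inE relabelM.
Qed.

(** * Distances on the cycle Z/n *)

Section Cycle.

Variable m : nat.
Local Notation n := m.+1.

Lemma val_subZp (u v : 'I_n) :
  (u - v)%R = (if v <= u then u - v else n + u - v) :> nat.
Proof.
have [lt_u lt_v] := (ltn_ord u, ltn_ord v); rewrite /= modnDmr.
case: leqP => [le_vu | lt_uv]; last by rewrite modn_small; lia.
have ->: u + (n - v) = u - v + n by lia.
by rewrite modnDr modn_small; lia.
Qed.

(* Seen from a fixed element of J, the others lie at a distance d with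
   0 < d < c or n - c < d < n; the distances d and d + (n - c) exclude each
   other. *)
Lemma card_cross_arcs (c : nat) (J : {set 'I_n}) :
  2 * c <= n ->
  (forall i j, i \in J -> j \in J -> (i - j)%R < c \/ n - c < (i - j)%R) ->
  #|J| <= c.
Proof.
move=> le_2c_n near; have [->|[i0 Ji0]] := set_0Vmem J; first by rewrite cards0.
have c_gt0 : 0 < c by have := near i0 i0 Ji0 Ji0; rewrite GRing.subrr => -[].
case: c => // c in le_2c_n near c_gt0 *.
(* [g] folds the two ranges of distances onto [[0, c]], where [c.+1] is the original bound; it
   remains to see that [g] is injective on [J]. *)
pose g (i : 'I_n) := let d := val (i - i0)%R in
  if d < c.+1 then d else d - (n - c.+1).
have lt_g i : i \in J -> g i < c.+1.
  move=> /near/(_ Ji0); have := ltn_ord (i - i0)%R.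
  by rewrite /g /=; case: ifP; lia.
rewrite -(@card_in_imset _ _ (fun i => inord (g i) : 'I_c.+1)).
  by rewrite -[X in _ <= X]card_ord max_card.
move=> i j Ji Jj /(congr1 val) /=; rewrite !inordK ?lt_g // => eq_g.
apply: (GRing.addIr (- i0)%R); apply: val_inj.
have := near i i0 Ji Ji0; have := near j i0 Jj Ji0.
have := near i j Ji Jj; have := near j i Jj Ji.
(* Everything is expressed through the two distances from [i0], which leaves linear arithmetic. *)
have subE k l : (k - l = (k - i0) - (l - i0))%R.
  by rewrite GRing.opprB GRing.addrA GRing.subrK.
rewrite (subE i j) (subE j i) (val_subZp (i - i0)%R) (val_subZp (j - i0)%R).
move: eq_g (ltn_ord (i - i0)%R) (ltn_ord (j - i0)%R); rewrite /g.
move: (i - i0)%R (j - i0)%R => [d ltd] [e lte] /=; do !case: ifP => ?; lia.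
Qed.

(** * Rotations of a flag made of arcs *)

Definition rotation (i : 'I_n) : {perm 'I_n} := perm (GRing.addIr i).

Definition arc_flag (a b : nat) : {set 'I_n} * {set 'I_n} :=
  ([set x : 'I_n | b <= x < b + a], [set x : 'I_n | n - b <= x]).

Lemma card_ord_interval (k l : nat) :
  l <= n -> #|[set x : 'I_n | k <= x < l]| = l - k.
Proof.
move=> le_ln; rewrite -sum1_card -[RHS]muln1 -sum_nat_const_nat.
rewrite (big_nat_widen _ _ _ _ _ le_ln) (big_nat_widenl _ _ _ _ _ (leq0n k)).
by rewrite big_mkord; apply: eq_bigl => x; rewrite inE andbC.
Qed.

Lemma arc_flagP a b :
  n < 2 * b -> a + 3 * b <= 2 * n -> is_flag a b (arc_flag a b).
Proof.
move=> lt_n_2b le_a3b_2n; apply/and3P; split=> /=.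
- by apply/subsetP => x; rewrite !inE; lia.
- by rewrite card_ord_interval; lia.
have ->: [set x : 'I_n | n - b <= x] = [set x : 'I_n | n - b <= x < n].
  by apply/setP => x; rewrite !inE ltn_ord andbT.
by rewrite card_ord_interval //; lia.
Qed.

Lemma Gamma_rotation a b (s : {perm 'I_n}) (i j : 'I_n) (f g : flag n a b) :
  n < 2 * b -> a + 3 * b <= 2 * n ->
  n - b <= (i - j)%R <= b ->
  val f = relabel s (relabel (rotation i) (arc_flag a b)) ->
  val g = relabel s (relabel (rotation j) (arc_flag a b)) ->
  Gamma n a b f g.
Proof.
move=> lt_n_2b le_a3b_2n dist_ij.
case: f g => [[A B] /= fP] [[A' B'] /= gP] [defA defB] [defA' defB'].
rewrite /Gamma /= /general_position.
have distE x : n - b <= (s x + i - (s x + j))%R <= b.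
  by rewrite GRing.opprD GRing.addrACA GRing.subrr GRing.add0r.
(* [u] and [v] are the positions of [x] relative to the two rotated flags; their difference [i - j]
   does not depend on [x]. *)
have mem x : exists u v : 'I_n, [/\ n - b <= (u - v)%R <= b,
   (x \in A) = (b <= u < b + a), (x \in B) = (n - b <= u),
   (x \in A') = (b <= v < b + a) & (x \in B') = (n - b <= v)].
  exists (s x + i)%R, (s x + j)%R; rewrite distE.
  by rewrite defA defB defA' defB' !inE !permE.
(* Only [B] and [B'] cover the cycle; the other pairs are disjoint. If [u] is in [[b, b + a)], then
   [v < a + 2 * b - n <= n - b], so [A] misses [B']; likewise [B] misses [A']. *)
apply/and4P; split; apply/orP; [right|right|right|left];
  apply/eqP/setP => x; have [u [v []]] := mem x;
  rewrite val_subZp !inE => + EA EB EA' EB';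
  rewrite ?EA ?EB ?EA' ?EB';
  have := ltn_ord u; have := ltn_ord v; case: ifP; lia.
Qed.

(** * The upper bound and the extremal family *)

Lemma independent_Gamma_bound a b (S : {set flag n a b}) :
  n < 2 * b -> a + 3 * b <= 2 * n ->
  independent (Gamma n a b) S ->
  n * #|S| <= (n - b) * ('C(n, b) * 'C(b, a)).
Proof.
move=> lt_n_2b le_a3b_2n indS.
pose V := [set p : {set 'I_n} * {set 'I_n} | is_flag a b p].
have F0P := arc_flagP lt_n_2b le_a3b_2n.
have <- : #|V| = 'C(n, b) * 'C(b, a).
  rewrite -[in 'C(n, b)](card_ord n) -cardsT -card_flags_within.
  by apply: eq_card => p; rewrite !inE subsetT andbT.
rewrite -(card_imset S val_inj) -[X in X * _](card_ord n).
apply: (@orbit_averaging _ _ (arc_flag a b) V _ rotation).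
- by move=> s; rewrite inE relabel_flag.
- by move=> F; rewrite inE; apply: relabel_transitive.
- by apply/subsetP => _ /imsetP[f _ ->]; rewrite inE (valP f).
move=> s; apply: card_cross_arcs => [|i j]; first lia.
rewrite !inE => /imsetP[f Sf def_f] /imsetP[g Sg def_g].
have /forall_inP/(_ f Sf)/forall_inP/(_ g Sg) := indS.
(* A distance failing both alternatives lies in [[n - b, b]], so [f] and [g] would be adjacent. *)
case: (ltnP (i - j)%R (n - b)) => [|ge_d]; first by left.
case: (ltnP (n - (n - b)) (i - j)%R) => [|le_d]; first by right.
case/negP; apply: (Gamma_rotation (s := s) (i := i) (j := j)) => //.
by apply/andP; split; last lia.
Qed.

(** [B] and [B'] both miss [x], so they do not cover, and they are too large to be disjoint. *)
Lemma independent_Gamma_avoid a b (x : 'I_n) :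
  n < 2 * b -> independent (Gamma n a b) [set f : flag n a b | x \notin (val f).2].
Proof.
move=> lt_n_2b; apply/forall_inP => f xf; apply/forall_inP => g xg.
move: xf xg; rewrite !inE.
case: f g => [[A B] /= fP] [[A' B'] /= gP] xB xB'; rewrite /Gamma /=.
have /and3P[/= _ _ /eqP cB] := fP; have /and3P[/= _ _ /eqP cB'] := gP.
apply/negP => /and4P[_ _ _ /orP[] /eqP eqBB'].
  by have := in_setT x; rewrite -eqBB' inE (negPf xB) (negPf xB').
have := max_card (mem (B :|: B')).
by rewrite card_ord cardsU eqBB' cards0 cB cB'; lia.
Qed.

Lemma card_avoid a b (x : 'I_n) :
  #|[set f : flag n a b | x \notin (val f).2]| = 'C(m, b) * 'C(b, a).
Proof.
have cD : #|[set~ x]| = m by rewrite cardsC1 card_ord.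
rewrite -[in RHS]cD -card_flags_within -(card_imset _ val_inj); apply: eq_card => p.
rewrite !inE -[_ \subset [set~ x]]disjoints_subset disjoint_sym disjoints1.
apply/imsetP/idP => [[f] | /and4P[sAB cA cB xB]].
  by rewrite inE => xf ->; have /and3P[-> -> ->] := valP f.
have fp : is_flag a b p by apply/and3P.
by exists (Sub p fp); rewrite ?inE ?SubK.
Qed.

End Cycle.

Theorem mainTheorem9 (n a b : nat)
    (n_gt0 : 0 < n) (a_gt0 : 0 < a) (b_gt0 : 0 < b)
    (lt_n_2b : n < 2 * b) (le_a3b_2n : a + 3 * b <= 2 * n) :
  independence_number (Gamma n a b) = 'C(n.-1, b) * 'C(b, a).
Proof.
case: n n_gt0 lt_n_2b le_a3b_2n => // m _ lt_n_2b le_a3b_2n.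
apply/eqP; rewrite eqn_leq; apply/andP; split.
  apply/bigmax_leqP => S /(independent_Gamma_bound lt_n_2b le_a3b_2n).
  (* With [n = m.+1], [(n - b) * 'C(n, b) = n * 'C(n.-1, b)], and the factor [n] cancels. *)
  by rewrite mulnA -mul_bin_down -mulnA leq_pmul2l.
rewrite -(card_avoid a b (ord0 : 'I_m.+1)) /independence_number.
exact/leq_bigmax_cond/independent_Gamma_avoid.
Qed.
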